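(* Let $f:K\to K$ be a homeomorphism of a compact set $K$ and let $A:K\to\mathrm{SL}(2,\mathbb{R})$ be a continuous map. Then the following are equivalent: (a) $(f,A)$ has uniform subexponential growth: for every $\epsilon>0$ there exists $N>0$ such that $\|A_n(x)\|\le e^{\epsilon n}$ for every $x\in K$ and every $n\ge N$; (b) for every $\epsilon>0$ there exists $n>0$ such that $\|A_n(x)\|\le e^{\epsilon n}$ for every $x\in K$; (c) $L(f,A,\mu)=0$ for every $f$-invariant probability measure $\mu$.
   Context: The cocycle $(f,A)$ acts on $K\times\mathbb{R}^2$ by $(x,y)\mapsto(f(x),A(x)\cdot y)$, and its iterates are denoted $(f,A)^n=(f^n,A_n)$; thus for integers $n\ge1$, $A_n(x)=A(f^{n-1}(x))\cdots A(f(x))A(x)$. Here $\|\cdot\|$ is the Euclidean norm on $\mathbb{R}^2$ and, for matrices, the operator norm it induces. For an $f$-invariant probability measure $\mu$ on $K$, the Lyapunov exponent of the cocycle $(f,A)$ with respect to $\mu$ is $L(f,A,\mu)=\lim_{n\to\infty}\frac1n\int_K\log\|A_n\|\,d\mu$. *)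

(* Defs.v *)
From HB Require Import structures.
From mathcomp Require Import all_boot all_order all_algebra.
From mathcomp Require Import all_classical all_reals all_analysis.
Import Order.TTheory GRing.Theory Num.Theory.
Import numFieldNormedType.Exports.

Set Implicit Arguments.
Unset Strict Implicit.
Unset Printing Implicit Defensive.

Local Open Scope classical_set_scope.
Local Open Scope ring_scope.

Definition homeomorphism (K : topologicalType) (f : K -> K) : Prop :=
  exists g : K -> K,
    [/\ continuous f, continuous g, cancel f g & cancel g f].

(* The library norm `|_| on matrices is the max norm, hence these two. *)
Definition eucl_norm (R : realType) (d : nat) (y : 'cV[R]_d) : R :=
  Num.sqrt (\sum_(i < d) y i 0 ^+ 2).

Definition op_norm (R : realType) (d : nat) (M : 'M[R]_d) : R :=
  sup [set eucl_norm (M *m y) | y in [set y : 'cV[R]_d | eucl_norm y <= 1]].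

Fixpoint cocycle (R : realType) (K : Type) (f : K -> K) (A : K -> 'M[R]_2)
    (n : nat) (x : K) : 'M[R]_2 :=
  if n is m.+1 then A (iter m f x) *m cocycle f A m x else 1%:M.

Definition borelType (K : ptopologicalType) := g_sigma_algebraType (@open K).

Definition invariant_measure (R : realType) (K : ptopologicalType) (f : K -> K)
    (mu : probability (borelType K) R) : Prop :=
  forall B : set (borelType K), measurable B -> mu (f @^-1` B) = mu B.

(* lim is a total operator. For A continuous with values in SL(2,R) on a compact
   space and mu invariant, each integral is finite and the sequence converges,
   the integrals being subadditive in n and nonnegative.
   The term n = 0 is 0, since 0^-1 = 0. *)
Definition lyapunov_exponent (R : realType) (K : ptopologicalType)
    (f : K -> K) (A : K -> 'M[R]_2) (mu : probability (borelType K) R) : R :=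
  lim ((fun n : nat =>
    n%:R^-1 * \int[mu]_x ln (op_norm (cocycle f A n x))) @ \oo).

(* Main.v *)
From HB Require Import structures.
Require Import Defs.
From mathcomp Require Import all_boot all_order all_algebra.
From mathcomp Require Import all_classical all_reals all_analysis.
From mathcomp Require Import measurable_realfun ring lra.
Import Order.TTheory GRing.Theory Num.Theory.
Import numFieldNormedType.Exports.
Local Open Scope classical_set_scope.
Local Open Scope ring_scope.

Set Implicit Arguments.
Unset Strict Implicit.
Unset Printing Implicit Defensive.

(** Write phi_n(x) = ln ||A_n(x)||. Since det A = 1, every norm is at least 1, so
    phi_n is a nonnegative continuous function, and submultiplicativity of the
    norm makes it subadditive over f: phi_{m+n} <= phi_m o f^n + phi_n. The three
    conditions are statements about such a family; matrices enter only through
    this reduction.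

    (a) and (b). The numbers S_n = sup_x phi_n(x) are finite by compactness and
    form a subadditive sequence. For such a sequence a bound S_n <= c n at a
    single time n > 0 gives S_k <= (c + e) k for all large k
    ([subadditive_eventually_le], the quantitative half of Fekete's lemma).

    (a) implies (c): the integral of phi_n / n is squeezed between 0 and e.

    (c) implies (b). If (b) fails, some e > 0 admits, for every n > 0, a point x_n
    with phi_n(x_n) > e n. The orbit segments x_n, f x_n, ..., f^(n-1) x_n produce
    an invariant probability mu with exponent at least e
    ([invariant_measure_of_orbit_segments], a Krylov-Bogolyubov theorem). As K need
    not be metrizable, mu is not obtained from a weakly convergent subsequence but
    in two steps:
    - an ultrafilter limit of the empirical measures is a finitely additive
      invariant probability nu defined on all subsets of K;
    - inner approximation of open sets by closed sets for nu, followed by outer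
      approximation by open sets, is an outer measure for which every open set is
      Caratheodory measurable; its restriction to the Borel sets is mu.
    The construction only moves mass onto closed sets: nu C <= mu C for C closed.
    Slicing a nonnegative continuous function into closed superlevel sets turns
    this inequality into a lower bound of its mu-integral by the limit of its
    averages along the segments. By [birkhoff_sum_ge], the average of phi_m over
    the n-th segment is at least m phi_n(x_n) / n - B / n > m e - B / n, hence the
    mu-integral of phi_m is at least m e for every m. These integrals are
    subadditive in m because mu is invariant, so Fekete's lemma makes the limit
    defining the exponent exist, and that limit is at least e > 0. *)

(** * Finitely additive probabilities *)

Record finitely_additive_probability (R : realType) (T : Type)
    (nu : set T -> R) : Prop := FinitelyAdditiveProbability {
  fap_ge0 : forall E, 0 <= nu E ;
  fap_setU : forall E F, E `&` F = set0 -> nu (E `|` F) = nu E + nu F ;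
  fap_setT : nu setT = 1 }.

Section FinitelyAdditive.
Context (R : realType) (T : Type) (nu : set T -> R).
Hypothesis nuP : finitely_additive_probability nu.

Lemma fap_le E F : E `<=` F -> nu E <= nu F.
Proof.
move=> EF; rewrite (_ : F = E `|` (F `\` E)); last by rewrite setDUK.
by rewrite (fap_setU nuP) ?setDIK// lerDl (fap_ge0 nuP).
Qed.

Lemma fap_subadditive E F : nu (E `|` F) <= nu E + nu F.
Proof.
rewrite (_ : E `|` F = E `|` (F `\` E)); last first.
  by rewrite seteqP; split=> x [Ex|]; [left| |left|case=> Fx _; right] => //;
    have [|] := pselect (E x); [left|right].
rewrite (fap_setU nuP) ?setDIK// lerD2l.
by apply: fap_le; exact: subDsetl.
Qed.

Lemma fap_le1 E : nu E <= 1.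
Proof. by rewrite -(fap_setT nuP) fap_le. Qed.

Lemma fap_set0 : nu set0 = 0.
Proof.
by apply: (@addrI _ (nu set0)); rewrite -(fap_setU nuP) ?setI0// setU0 addr0.
Qed.

End FinitelyAdditive.

(** * The regular Borel probability dominating a finitely additive one *)

Section RegularMeasure.
Context (R : realType) (K : ptopologicalType).
Hypotheses (hausK : hausdorff_space K) (compK : compact [set: K]).
Variable nu : set K -> R.
Hypothesis nuP : finitely_additive_probability nu.
Implicit Types (C E U V : set K).
Local Open Scope ereal_scope.

Definition inner_content U : \bar R :=
  ereal_sup [set (nu C)%:E | C in [set C | closed C /\ C `<=` U]].

Definition regular_outer E : \bar R :=
  ereal_inf [set inner_content U | U in [set U | open U /\ E `<=` U]].

Lemma le_inner_content C U : closed C -> C `<=` U -> (nu C)%:E <= inner_content U.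
Proof. by move=> cC CU; apply: ereal_sup_ubound; exists C. Qed.

Lemma inner_content_le U V : U `<=` V -> inner_content U <= inner_content V.
Proof.
move=> UV; apply: ge_ereal_sup => _ [C [cC CU] <-].
by apply: le_inner_content => //; exact: subset_trans CU UV.
Qed.

Lemma inner_content_ge0 U : 0 <= inner_content U.
Proof.
have <- : (nu set0)%:E = 0 by rewrite (fap_set0 nuP).
by apply: le_inner_content => //; exact: closed0.
Qed.

Lemma inner_content_le1 U : inner_content U <= 1.
Proof. by apply: ge_ereal_sup => _ [C _ <-]; rewrite lee_fin fap_le1. Qed.

Lemma inner_content_fin_num U : inner_content U \is a fin_num.
Proof.
rewrite ge0_fin_numE ?inner_content_ge0//.
exact: le_lt_trans (inner_content_le1 U) (ltry _).
Qed.

Lemma inner_content_adherent U (e : R) : (0 < e)%R -> exists C,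
  [/\ closed C, C `<=` U & inner_content U <= (nu C)%:E + e%:E].
Proof.
move=> e0; have [_ [C [cC CU] <-]] :=
  ub_ereal_sup_adherent e0 (inner_content_fin_num U).
by rewrite lteBlDr// => /ltW Ue; exists C.
Qed.

(** Shrinking an open cover by two sets: normality separates the two disjoint
    closed sets formed by the points of [C] that only one of [U], [V] covers. *)
Lemma closed_setU_split C U V : closed C -> open U -> open V ->
  C `<=` U `|` V -> exists C1 C2, [/\ closed C1, closed C2, C1 `<=` U, C2 `<=` V
    & C `<=` C1 `|` C2].
Proof.
move=> cC oU oV CUV.
have cCU : closed (C `\` U) by apply: closedI => //; exact: open_closedC.
have cCV : closed (C `\` V) by apply: closedI => //; exact: open_closedC.
have dis : (C `\` U) `&` (C `\` V) = set0.
  by rewrite -subset0 => x [[Cx nU] [_ nV]]; have [] := CUV x Cx.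
have /(@normal_openP R) nK : normal_space K by exact: compact_normal.
have [W1 [W2 [oW1 oW2 CW1 CW2 W12]]] := nK _ _ cCU cCV dis.
exists (C `\` W1), (C `\` W2); split.
- by apply: closedI => //; exact: open_closedC.
- by apply: closedI => //; exact: open_closedC.
- by move=> x [Cx nW]; apply: contrapT => nU; apply: nW; apply: CW1.
- by move=> x [Cx nW]; apply: contrapT => nU; apply: nW; apply: CW2.
- move=> x Cx; have [W1x|] := pselect (W1 x); last by left.
  by right; split=> // W2x; have : (W1 `&` W2) x by []; rewrite W12.
Qed.

Lemma le_inner_content_bigsetU n (U : nat -> set K) C :
  (forall i, open (U i)) -> closed C -> C `<=` \big[setU/set0]_(i < n) U i ->
  (nu C)%:E <= \sum_(i < n) inner_content (U i).
Proof.
move=> oU; elim: n C => [|n IHn] C cC; rewrite !(big_ord0, big_ord_recr)/=.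
  by rewrite subset0 => ->; rewrite fap_set0.
have oUn : open (\big[setU/set0]_(i < n) U i).
  by elim/big_ind : _ => //; [exact: open0|exact: openU].
move=> /(closed_setU_split cC oUn (oU n)) [C1 [C2 [cC1 cC2 CU1 CU2 CC]]].
apply: (@le_trans _ _ ((nu C1)%:E + (nu C2)%:E)).
  rewrite -EFinD lee_fin (le_trans _ (fap_subadditive nuP _ _))//.
  exact: fap_le.
by apply: leeD; [exact: IHn|exact: le_inner_content].
Qed.

(** Countable subadditivity on open sets is where compactness enters: a closed
    subset of the union is covered by finitely many of the sets, so finite
    subadditivity of [nu] suffices. *)
Lemma inner_content_sigma_subadditive (U : nat -> set K) :
  (forall i, open (U i)) ->
  inner_content (\bigcup_i U i) <= \sum_(i <oo) inner_content (U i).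
Proof.
move=> oU; apply: ge_ereal_sup => _ [C [cC CU] <-].
have : cover_compact C.
  by rewrite -compact_cover; apply: subclosed_compact cC compK _.
move=> /(_ nat setT U (fun i _ => oU i) CU) [D _ CD].
pose n := (\max_(i <- finmap.enum_fset D) i).+1.
apply: (@le_trans _ _ (\sum_(i < n) inner_content (U i))).
  apply: le_inner_content_bigsetU => // x /CD [i /= iD Uix].
  rewrite -bigcup_mkord; exists i => //=.
  by rewrite ltnS; apply: leq_bigmax_seq.
rewrite (nneseries_split 0 n); last by move=> *; exact: inner_content_ge0.
rewrite big_mkord leeDl// nneseries_ge0// => *; exact: inner_content_ge0.
Qed.

Lemma regular_outer_open U : open U -> regular_outer U = inner_content U.
Proof.
move=> oU; apply/eqP; rewrite eq_le; apply/andP; split.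
  by apply: ereal_inf_lbound; exists U => //; split.
by apply: le_ereal_inf_tmp => _ [V [oV UV] <-]; exact: inner_content_le.
Qed.

Lemma regular_outer_ge0 E : 0 <= regular_outer E.
Proof. by apply: le_ereal_inf_tmp => _ [U _ <-]; exact: inner_content_ge0. Qed.

Lemma regular_outer_le E F : E `<=` F -> regular_outer E <= regular_outer F.
Proof.
move=> EF; apply: le_ereal_inf_tmp => _ [U [oU FU] <-].
by apply: ereal_inf_lbound; exists U => //; split => //; exact: subset_trans FU.
Qed.

Lemma regular_outer_setT : regular_outer setT = 1.
Proof.
rewrite (regular_outer_open openT); apply/eqP.
rewrite eq_le inner_content_le1/= -(fap_setT nuP).
by apply: le_inner_content => //; exact: closedT.
Qed.

Lemma regular_outer_set0 : regular_outer set0 = 0.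
Proof.
rewrite (regular_outer_open open0); apply/eqP; rewrite eq_le inner_content_ge0.
rewrite andbT; apply: ge_ereal_sup => y [C [_ ]].
by rewrite subset0 => C0 <-; rewrite C0 fap_set0.
Qed.

Lemma regular_outer_fin_num E : regular_outer E \is a fin_num.
Proof.
rewrite ge0_fin_numE ?regular_outer_ge0//.
by rewrite (le_lt_trans (regular_outer_le (@subsetT _ E)))// regular_outer_setT ltry.
Qed.

Lemma regular_outer_adherent E (e : R) : (0 < e)%R -> exists U,
  [/\ open U, E `<=` U & inner_content U <= regular_outer E + e%:E].
Proof.
move=> e0; have [_ [U [oU EU] <-]] :=
  lb_ereal_inf_adherent e0 (regular_outer_fin_num E).
by move=> /ltW Ue; exists U.
Qed.

(** Closed sets only gain mass. Equality fails in general: mass of [nu] drifting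
    towards [C] from outside ends up on [C]. *)
Lemma le_regular_outer_closed C : closed C -> (nu C)%:E <= regular_outer C.
Proof.
move=> cC; apply: le_ereal_inf_tmp => _ [U [_ CU] <-].
exact: le_inner_content.
Qed.

Lemma regular_outer_sigma_subadditive : sigma_subadditive regular_outer.
Proof.
move=> F; apply/lee_addgt0Pr => e e0.
rewrite (le_trans _ (epsilon_trick _ _ (ltW e0)))//; last first.
  by move=> n; exact: regular_outer_ge0.
have en n : (0 < e / (2 ^ n.+1)%:R)%R by rewrite divr_gt0// ltr0n expn_gt0.
have /choice[U UP] n := regular_outer_adherent (F n) (en n).
apply: (@le_trans _ _ (\sum_(i <oo) inner_content (U i))).
  apply: (le_trans _ (inner_content_sigma_subadditive _)) => [|n]; last first.
    by case: (UP n).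
  apply: ereal_inf_lbound; exists (\bigcup_n U n) => //; split.
    by apply: bigcup_open => n _; case: (UP n).
  by apply: subset_bigcup => n _; case: (UP n).
apply: lee_nneseries => n _ *; first exact: inner_content_ge0.
by case: (UP n).
Qed.

(** In an open [V] containing [X], exhaust [V `&` U] by a closed [C] and then
    [V `\` C], which contains [V `\` U], by a closed [D]: as [C] and [D] are
    disjoint subsets of [V], finite additivity of [nu] bounds the sum. *)
Lemma regular_outer_caratheodory_open U X : open U ->
  regular_outer (X `&` U) + regular_outer (X `&` ~` U) <= regular_outer X.
Proof.
move=> oU; apply: le_ereal_inf_tmp => _ [V [oV XV] <-].
apply: (@le_trans _ _ (regular_outer (V `&` U) + regular_outer (V `&` ~` U))).
  by apply: leeD; apply: regular_outer_le; exact: setSI.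
rewrite (regular_outer_open (openI oV oU)).
apply/lee_addgt0Pr => e e0.
have e20 : (0 < e / 2)%R by rewrite divr_gt0.
have [C [cC CVU Ce]] := inner_content_adherent (V `&` U) e20.
have oVC : open (V `\` C) by apply: openI => //; exact: closed_openC.
have [D [cD DVC De]] := inner_content_adherent (V `\` C) e20.
have VU : regular_outer (V `&` ~` U) <= inner_content (V `\` C).
  rewrite -regular_outer_open//; apply: regular_outer_le => x [Vx nUx].
  by split=> // /CVU [].
apply: le_trans (leeD Ce (le_trans VU De)) _.
rewrite addeACA -!EFinD -splitr EFinD leeD2r//.
rewrite -(fap_setU nuP); last by rewrite -subset0 => x [Cx /DVC []].
apply: le_inner_content; first exact: closedU.
by move=> x [/CVU []|/DVC []].
Qed.

(** Caratheodory's theorem: the measurable sets of an outer measure form a sigma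
    algebra on which it is countably additive, and this sigma algebra contains
    the Borel sets as soon as it contains the open ones. *)
Lemma borel_regular_extension : exists mu : probability (borelType K) R,
  forall B : set K, mu B = regular_outer B.
Proof.
have om := isOuterMeasure.Build R K regular_outer regular_outer_set0
  regular_outer_ge0 regular_outer_le regular_outer_sigma_subadditive.
pose out : {outer_measure set K -> \bar R} := HB.pack regular_outer om.
have sub (B : set (borelType K)) : measurable B -> out.-cara.-measurable B.
  apply: smallest_sub => [|U oU].
    split; first exact: measurable0.
      by move=> A mA; rewrite setTD; exact: measurableC.
    by move=> A mA; exact: bigcup_measurable.
  by apply: le_caratheodory_measurable => X; exact: regular_outer_caratheodory_open.
have add : semi_sigma_additive (regular_outer : set (borelType K) -> \bar R).
  move=> A mA tA mUA.
  by apply: (caratheodory_measure_sigma_additive (mu := out)) => // [i|];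
    exact: sub.
have im := isMeasure.Build _ (borelType K) R regular_outer regular_outer_set0
  regular_outer_ge0 add.
pose m : {measure set (borelType K) -> \bar R} := HB.pack
  (regular_outer : set (borelType K) -> \bar R) im.
have ip := Measure_isProbability.Build _ (borelType K) R m regular_outer_setT.
pose p : probability (borelType K) R := HB.pack
  (regular_outer : set (borelType K) -> \bar R) im ip.
by exists p.
Qed.

End RegularMeasure.

Section Invariance.
Context (R : realType) (K : ptopologicalType) (nu : set K -> R).
Implicit Types E U : set K.
Local Open Scope ereal_scope.

Let inner_content_preimage_le (f g : K -> K) U :
  continuous g -> cancel f g -> cancel g f ->
  (forall E, nu (f @^-1` E) = nu E) ->
  inner_content nu (f @^-1` U) <= inner_content nu U.
Proof.
move=> cg fK gK nuf; apply: ge_ereal_sup => _ [C [cC CU] <-].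
have -> : nu C = nu (g @^-1` C).
  by rewrite -[RHS]nuf; congr nu; apply/funext=> y; rewrite /preimage/= fK.
apply: le_inner_content; first exact: preimage_closed.
by move=> y /CU; rewrite /preimage/= gK.
Qed.

Let regular_outer_preimage_le (f g : K -> K) E :
  continuous f -> continuous g -> cancel f g -> cancel g f ->
  (forall E, nu (f @^-1` E) = nu E) ->
  regular_outer nu (f @^-1` E) <= regular_outer nu E.
Proof.
move=> cf cg fK gK nuf; apply: le_ereal_inf_tmp => _ [U [oU EU] <-].
apply: le_trans (inner_content_preimage_le U cg fK gK nuf).
apply: ereal_inf_lbound; exists (f @^-1` U) => //; split.
  by apply: open_comp => // y _; exact: cf.
exact: preimage_subset.
Qed.

(** A homeomorphism permutes the open sets and the closed sets, so the two
    approximations defining [regular_outer] inherit the invariance of [nu]. One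
    inequality for [f] and the same one for its inverse give the equality. *)
Lemma regular_outer_preimage (f : K -> K) E : homeomorphism f ->
  (forall E, nu (f @^-1` E) = nu E) ->
  regular_outer nu (f @^-1` E) = regular_outer nu E.
Proof.
move=> [g [cf cg fK gK]] nuf; apply/eqP; rewrite eq_le.
rewrite (regular_outer_preimage_le _ cf cg)//=.
have nug F : nu (g @^-1` F) = nu F.
  by rewrite -nuf; congr nu; apply/funext=> y; rewrite /preimage/= fK.
have := regular_outer_preimage_le (f @^-1` E) cg cf gK fK nug.
by congr (_ <= _); congr (regular_outer nu); apply/funext=> y;
  rewrite /preimage/= gK.
Qed.

End Invariance.

(** * Limits of empirical measures along an ultrafilter *)

(** Compactness of [[a, b]] gives a cluster point, and an ultrafilter converges to
    each of its cluster points. *)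
Lemma cvg_ultra_itv (R : realType) (T : Type) (F : set_system T) (u : T -> R)
    (a b : R) : UltraFilter F -> (forall n, a <= u n <= b) -> cvg (u @ F).
Proof.
move=> UF uab.
have Fab : (u @ F) `[a, b]%classic.
  by apply: nearW => n; rewrite /= in_itv/= uab.
have [p [_ pcl]] := @segment_compact R a b _ _ Fab.
apply/cvg_ex; exists p => B pB; have [//|FnB] := in_ultra_setVsetC (u @^-1` B) UF.
have [y [nBy By]] := pcl (~` B) B FnB pB.
by [].
Qed.

Lemma cvg_natV (R : realType) : (fun n => n%:R^-1 : R) @ \oo --> (0 : R).
Proof. by rewrite -cvg_shiftS; exact: cvg_harmonic. Qed.

Lemma indic_itv (R : realType) (T : Type) (E : set T) y : 0 <= (\1_E y : R) <= 1.
Proof. by rewrite indicE; case: (y \in E); rewrite /= ?ler01 ?lexx. Qed.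

Section Empirical.
Context (R : realType) (K : Type) (f : K -> K) (x : nat -> K).

(** Each length has its own initial point: failure of uniform growth gives a
    different fast orbit for every time. *)
Definition segment_average (phi : K -> R) (n : nat) : R :=
  n%:R^-1 * \sum_(j < n) phi (iter j f (x n)).

Lemma segment_average_itv (phi : K -> R) (b : R) n :
  (forall y, 0 <= phi y <= b) -> 0 <= b -> 0 <= segment_average phi n <= b.
Proof.
move=> phib b0; have phi0 y : 0 <= phi y by case/andP: (phib y).
rewrite /segment_average mulr_ge0 ?sumr_ge0 ?invr_ge0//=.
case: n => [|n]; first by rewrite big_ord0 mulr0.
rewrite mulrC ler_pdivrMr// mulr_natr -[X in b *+ X]card_ord -sumr_const.
by apply: ler_sum => j _; case/andP: (phib (iter j f (x n.+1))).
Qed.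

Lemma segment_averageD (phi psi : K -> R) n :
  segment_average (phi \+ psi) n = segment_average phi n + segment_average psi n.
Proof. by rewrite /segment_average big_split/= mulrDr. Qed.

(** Composing with [f] shifts the segment by one step, so the sums telescope; the
    boundary term divided by [n] is what makes limits of averages invariant. *)
Lemma segment_average_comp (phi : K -> R) n :
  segment_average (phi \o f) n =
  segment_average phi n + n%:R^-1 * (phi (iter n f (x n)) - phi (x n)).
Proof.
rewrite /segment_average -mulrDr; congr (_ * _).
rewrite -(telescope_sumr (fun j => phi (iter j f (x n))) (leq0n n)) big_mkord.
by rewrite -big_split/=; apply: eq_bigr => j _; rewrite addrC subrK.
Qed.

Variable F : set_system nat.
Hypotheses (UF : UltraFilter F) (ooF : \oo `<=` F).

(** The ultrafilter makes the limit exist for all subsets at once, so that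
    additivity passes to the limit; it need not be countably additive. *)
Definition empirical_limit (E : set K) : R := lim (segment_average \1_E @ F).

Lemma cvg_empirical (E : set K) : segment_average \1_E @ F --> empirical_limit E.
Proof.
apply: (@cvg_ultra_itv _ _ _ _ 0 1) => n.
by apply: segment_average_itv => // y; exact: indic_itv.
Qed.

Lemma empirical_limit_fap : finitely_additive_probability empirical_limit.
Proof.
split=> [E|E G EG|].
- apply: limr_ge; first exact: cvg_empirical.
  apply: nearW => n.
  by have /andP[] := segment_average_itv n (indic_itv R E) ler01.
- apply/cvg_lim => //.
  rewrite (_ : segment_average _ = segment_average \1_E \+ segment_average \1_G).
    by apply: cvgD; exact: cvg_empirical.
  apply/funext => n /=; rewrite -segment_averageD; congr segment_average.
  apply/funext => y; rewrite /= !indicE in_setU.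
  case: (boolP (y \in E)) => [/set_mem Ey|_]; last by rewrite add0r.
  rewrite memNset ?addr0// => Gy.
  by have : (E `&` G) y by []; rewrite EG.
- apply: (@cvg_lim R) => //; apply: cvg_trans (@cvg_cst _ (1 : R) _ F _).
  apply: near_eq_cvg; apply: ooF; near=> n.
  rewrite /segment_average (eq_bigr (fun=> 1)); last first.
    by move=> j _; rewrite indicE in_setT.
  rewrite sumr_const card_ord mulVf// pnatr_eq0 -lt0n.
  by near: n; exact: nbhs_infty_gt.
Unshelve. all: by end_near. Qed.

Lemma empirical_limit_preimage (E : set K) :
  empirical_limit (f @^-1` E) = empirical_limit E.
Proof.
apply: (@cvg_lim R) => //.
have -> : \1_(f @^-1` E) = \1_E \o f :> (K -> R) by [].
rewrite [X in X @ _ --> _](_ : _ = segment_average \1_E \+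
   (fun n => n%:R^-1 * (\1_E (iter n f (x n)) - \1_E (x n)))); last first.
  by apply/funext => n; rewrite segment_average_comp.
rewrite -[X in _ --> X]addr0; apply: cvgD; first exact: cvg_empirical.
apply: (@cvg_trans _ ((fun n => n%:R^-1 * (\1_E (iter n f (x n)) - \1_E (x n)) : R) @ \oo)).
  exact: cvg_app.
apply: (@squeeze_cvgr _ _ _ R (fun n => - n%:R^-1) (fun n => n%:R^-1)).
- apply: nearW => n; rewrite -ler_norml normrM ger0_norm ?invr_ge0//.
  rewrite ler_piMr ?invr_ge0// !indicE.
  by do 2 case: (_ \in _); rewrite /= ?subrr ?subr0 ?sub0r ?normrN ?normr0 ?normr1.
- by rewrite -oppr0; apply: cvgN; exact: cvg_natV.
- exact: cvg_natV.
Qed.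

End Empirical.

(** * Approximation by superlevel sets *)

(** For [y] below the top level, the number of levels [delta], [2 * delta], ... not
    above [y], times [delta], approximates [y] from below within [delta]. *)
Section LayerCake.
Context (R : realType) (delta : R).
Hypothesis delta0 : 0 < delta.

Let layers (y : R) M : R := \sum_(i < M) delta * (i.+1%:R * delta <= y)%R%:R.

Let layers_full y M : M%:R * delta <= y -> layers y M = M%:R * delta.
Proof.
move=> My; rewrite /layers (eq_bigr (fun=> delta)); last first.
  move=> i _; rewrite (le_trans _ My) ?mulr1//.
  by rewrite ler_pM2r// ler_nat.
by rewrite sumr_const card_ord mulr_natl.
Qed.

Lemma layers_le y M : 0 <= y ->
  \sum_(i < M) delta * (i.+1%:R * delta <= y)%R%:R <= y.
Proof.
move=> y0; elim: M => [|M IHM]; first by rewrite big_ord0.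
have [My|yM] := leP (M.+1%:R * delta) y.
  by have := layers_full My; rewrite /layers => ->.
by rewrite big_ord_recr/= (lt_geF yM) mulr0 addr0.
Qed.

Lemma layers_ge y M : 0 <= y < M.+1%:R * delta ->
  y - delta <= \sum_(i < M) delta * (i.+1%:R * delta <= y)%R%:R.
Proof.
elim: M => [|M IHM] /andP[y0 yM].
  by rewrite big_ord0 subr_le0 ltW// (lt_le_trans yM)// mul1r.
have [My|yM'] := leP (M.+1%:R * delta) y.
  have := layers_full My; rewrite /layers => ->.
  by rewrite lerBlDr -[X in _ + X]mul1r -mulrDl natr1 ltW.
rewrite big_ord_recr/= (lt_geF yM') mulr0 addr0.
by apply: IHM; rewrite y0.
Qed.

End LayerCake.

(** * Continuous functions and Borel sets *)

Section BorelContinuous.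
Context (R : realType) (K : ptopologicalType).

Lemma open_measurable_borel (U : set K) :
  open U -> measurable (U : set (borelType K)).
Proof. exact: sub_sigma_algebra. Qed.

Lemma closed_measurable_borel (C : set K) :
  closed C -> measurable (C : set (borelType K)).
Proof.
by move=> /closed_openC/open_measurable_borel/measurableC; rewrite setCK.
Qed.

Lemma continuous_measurable_borel (phi : K -> R) :
  continuous phi -> measurable_fun setT (phi : borelType K -> R).
Proof.
move=> /continuousP cphi; apply: (measurability _ (RGenOpens.measurableE R)).
move=> _ [_ [a [b ->] <-]]; rewrite setTI; apply: open_measurable_borel.
exact/cphi/interval_open.
Qed.

Lemma continuous_measurable_borel_self (f : K -> K) :
  continuous f -> measurable_fun setT (f : borelType K -> borelType K).
Proof.
move=> /continuousP cf; apply: (@measurability _ _ (borelType K)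
  (borelType K) setT f (@open K)) => //.
by move=> _ [U oU <-]; rewrite setTI; apply: open_measurable_borel; exact: cf.
Qed.

Lemma compact_continuous_ub (phi : K -> R) : compact [set: K] ->
  continuous phi -> exists b : R, forall y, `|phi y| < b.
Proof.
move=> compK cphi.
have : compact (phi @` setT).
  by apply: continuous_compact => //; exact: continuous_subspaceT.
move=> /compact_bounded [b [_ bP]]; exists (b + 1 + 1) => y.
have := bP (b + 1); rewrite ltrDl ltr01 => /(_ isT (phi y)).
by move=> /(_ (ex_intro2 _ _ y I erefl)) /= /le_lt_trans; apply; rewrite ltrDl.
Qed.

Lemma continuous_integrable_borel (mu : probability (borelType K) R)
    (phi : K -> R) : compact [set: K] -> continuous phi ->
  mu.-integrable setT (EFin \o phi).
Proof.
move=> compK cphi; apply: measurable_bounded_integrable => //.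
- by rewrite -ge0_fin_numE ?fin_num_measure.
- exact: continuous_measurable_borel.
- have [b bP] := compact_continuous_ub compK cphi.
  exists b; split; rewrite ?num_real// => c bc y _ /=.
  by apply: ltW; exact: lt_trans (bP y) bc.
Qed.

End BorelContinuous.

(** * Invariant measures from long orbit segments *)

(** Lower bounds for [phi] along the segments survive in the [mu]-integral: below
    [phi] lies a combination of indicators of closed superlevel sets, within
    [delta] of [phi]; its segment averages converge to its integral against [nu],
    and passing from [nu] to [mu] can only increase the measure of these sets. *)
Theorem invariant_measure_of_orbit_segments (R : realType) (K : ptopologicalType)
    (hausK : hausdorff_space K) (compK : compact [set: K])
    (f : K -> K) (homeof : homeomorphism f) (x : nat -> K) :
  exists mu : probability (borelType K) R, invariant_measure f mu /\
    forall (phi : K -> R) (c : R), continuous phi -> (forall y, 0 <= phi y) ->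
      (\forall n \near \oo, c <= segment_average f x phi n) ->
      c <= \int[mu]_y phi y.
Proof.
have [F [UF ooF]] := ultraFilterLemma eventually_filter.
pose nu : set K -> R := empirical_limit R f x F.
have nuP : finitely_additive_probability nu by exact: empirical_limit_fap.
have [mu muE] := borel_regular_extension hausK compK nuP.
exists mu; split=> [B mB|phi c cphi phi0 cn].
  rewrite !muE; apply: regular_outer_preimage => // E.
  exact: empirical_limit_preimage.
have iphi := continuous_integrable_borel mu compK cphi.
apply/ler_addgt0Pr => delta delta0.
have [b bP] := compact_continuous_ub compK cphi.
have [M bM] : exists M : nat, b <= M.+1%:R * delta.
  exists (Num.truncn (b / delta)); rewrite -ler_pdivrMr//.
  by rewrite ltW// truncnS_gt.
have phiM y : 0 <= phi y < M.+1%:R * delta.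
  by rewrite phi0/= (lt_le_trans _ bM)// (le_lt_trans (ler_norm _)).
pose C (i : nat) : set K := [set y | i.+1%:R * delta <= phi y].
have cC i : closed (C i).
  rewrite (_ : C i = phi @^-1` [set r | i.+1%:R * delta <= r])//.
  by apply: preimage_closed => //; exact: closed_ge.
have CE i y : \1_(C i) y = (i.+1%:R * delta <= phi y)%R%:R :> R.
  by rewrite indicE; congr (nat_of_bool _)%:R; apply/idP/idP => [/set_mem|/mem_set].
(* The middle term is the integral against nu of the step function made of the
   levels, plus the error delta of that step function. *)
apply: (@le_trans _ _ (\sum_(i < M) delta * nu (C i) + delta)).
  rewrite -lerBlDr.
  have lim_layers : (fun n => \sum_(i < M) delta * segment_average f x \1_(C i) n)
      @ F --> \sum_(i < M) delta * nu (C i).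
    apply: (cvg_big add_continuous) => i _.
    by apply: cvgM; [exact: cvg_cst|exact: cvg_empirical].
  rewrite -(cvg_lim _ lim_layers)//; apply: limr_ge.
    by apply/cvg_ex; eexists; exact: lim_layers.
  apply: ooF; near=> n.
  have n0 : (0 < n)%N by near: n; exact: nbhs_infty_gt.
  apply: (@le_trans _ _ (segment_average f x phi n - delta)).
    by rewrite lerB//; near: n.
  rewrite (_ : \sum_(i < M) _ =
    n%:R^-1 * \sum_(j < n) \sum_(i < M) delta * \1_(C i) (iter j f (x n))); last first.
    rewrite exchange_big mulr_sumr; apply: eq_bigr => i _.
    by rewrite /segment_average mulrCA -mulr_sumr.
  rewrite /segment_average [X in _ - X <= _](_ : _ = n%:R^-1 * \sum_(j < n) delta); last first.
    by rewrite sumr_const card_ord -[X in _ * X]mulr_natl mulKf// pnatr_eq0 -lt0n.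
  rewrite -mulrBr -sumrB ler_wpM2l// ler_sum// => j _.
  under eq_bigr do rewrite CE.
  exact: layers_ge.
rewrite lerD2r -lee_fin /Rintegral fineK; last exact: integrable_fin_num.
have mC i : measurable (C i : set (borelType K)) by exact: closed_measurable_borel.
have m1C i : measurable_fun setT (\1_(C i) : borelType K -> R).
  exact: (@measurable_indic _ (borelType K) R setT (C i) (mC i)).
have mdC i : measurable_fun setT (fun y : borelType K => (delta * \1_(C i) y)%:E).
  apply/measurable_EFinP; exact: measurable_funM.
have dC0 i (y : borelType K) : (0 <= (delta * \1_(C i) y)%:E)%E.
  by rewrite lee_fin mulr_ge0// ltW.
apply: (@le_trans _ _ (\int[mu]_y (\sum_(i < M) (delta * \1_(C i) y)%:E))%E).
  rewrite ge0_integral_sum// -sumEFin; apply: lee_sum => i _.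
  rewrite EFinM; under eq_integral do rewrite EFinM.
  rewrite ge0_integralZl_EFin// ?(ltW delta0)//; last first.
    exact/measurable_EFinP.
  rewrite lee_wpmul2l// ?lee_fin ?(ltW delta0)// integral_indic// setIT.
  by have := le_regular_outer_closed nu (cC i); rewrite -muE.
apply: ge0_le_integral => //.
- by move=> y _; apply: sume_ge0.
- exact: emeasurable_sum.
- by apply/measurable_EFinP; exact: continuous_measurable_borel.
- move=> y _; rewrite sumEFin lee_fin.
  under eq_bigr do rewrite CE.
  exact: layers_le.
Unshelve. all: by end_near. Qed.

(** * The operator norm of the Euclidean norm *)

(** Lagrange's identity: twice the defect is the sum of the squares of all the
    2 x 2 minors of the two rows [a], [b]. *)
Lemma sum_cauchy_schwarz (R : realFieldType) (I : finType) (a b : I -> R) :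
  (\sum_i a i * b i) ^+ 2 <= (\sum_i a i ^+ 2) * (\sum_i b i ^+ 2).
Proof.
rewrite -subr_ge0 -(pmulr_rge0 _ (ltr0n R 2)).
suff -> : 2 * ((\sum_i a i ^+ 2) * (\sum_i b i ^+ 2) - (\sum_i a i * b i) ^+ 2) =
    \sum_i \sum_j (a i * b j - a j * b i) ^+ 2.
  by apply: sumr_ge0 => i _; apply: sumr_ge0 => j _; exact: sqr_ge0.
transitivity (\sum_i \sum_j (a i ^+ 2 * b j ^+ 2)
    + \sum_i \sum_j (a j ^+ 2 * b i ^+ 2) - 2 * \sum_i \sum_j (a i * b i) * (a j * b j)).
  rewrite [X in _ + X - _]exchange_big/= expr2 !big_distrlr/=.
  by ring.
rewrite mulr_sumr -big_split -sumrB; apply: eq_bigr => i _.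
rewrite mulr_sumr -big_split -sumrB; apply: eq_bigr => j _.
by rewrite /=; ring.
Qed.

Section EuclideanNorm.
Context (R : realType) (d : nat).
Implicit Types (y z : 'cV[R]_d) (M N : 'M[R]_d).

Lemma eucl_norm_ge0 y : 0 <= eucl_norm y.
Proof. exact: sqrtr_ge0. Qed.

Lemma eucl_norm_sqr y : eucl_norm y ^+ 2 = \sum_i y i 0 ^+ 2.
Proof. by rewrite sqr_sqrtr// sumr_ge0// => i _; exact: sqr_ge0. Qed.

Lemma eucl_normZ a y : eucl_norm (a *: y) = `|a| * eucl_norm y.
Proof.
rewrite /eucl_norm -sqrtr_sqr -sqrtrM ?sqr_ge0//; congr Num.sqrt.
by rewrite mulr_sumr; apply: eq_bigr => i _; rewrite mxE exprMn.
Qed.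

Lemma eucl_norm0 : eucl_norm (0 : 'cV[R]_d) = 0.
Proof. by rewrite -(scale0r (0 : 'cV[R]_d)) eucl_normZ normr0 mul0r. Qed.

Lemma eucl_normD y z : eucl_norm (y + z) <= eucl_norm y + eucl_norm z.
Proof.
rewrite -(@ler_pXn2r _ 2)// ?nnegrE ?addr_ge0 ?eucl_norm_ge0//.
have yz : \sum_i y i 0 * z i 0 <= eucl_norm y * eucl_norm z.
  apply: (le_trans (ler_norm _)).
  rewrite -(@ler_pXn2r _ 2)// ?nnegrE ?mulr_ge0 ?eucl_norm_ge0//.
  by rewrite real_normK ?num_real// exprMn !eucl_norm_sqr sum_cauchy_schwarz.
rewrite sqrrD !eucl_norm_sqr.
have -> : \sum_i (y + z) i 0 ^+ 2 =
    \sum_i y i 0 ^+ 2 + \sum_i y i 0 * z i 0 *+ 2 + \sum_i z i 0 ^+ 2.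
  by rewrite -!big_split; apply: eq_bigr => i _; rewrite mxE sqrrD.
by rewrite lerD2r lerD2l sumrMnl lerMn2r yz orbT.
Qed.

(** An upper bound of [op_norm] that is a continuous expression in the entries; it
    gives finiteness of the supremum and continuity of [op_norm]. *)
Definition frobenius_norm M : R := Num.sqrt (\sum_i \sum_j M i j ^+ 2).

Lemma eucl_norm_mul_frobenius M y :
  eucl_norm (M *m y) <= frobenius_norm M * eucl_norm y.
Proof.
rewrite /frobenius_norm /eucl_norm -sqrtrM; last first.
  by apply: sumr_ge0 => i _; apply: sumr_ge0 => j _; exact: sqr_ge0.
rewrite ler_wsqrtr// mulr_suml; apply: ler_sum => i _.
by rewrite mxE sum_cauchy_schwarz.
Qed.

Let unit_image M := [set eucl_norm (M *m y) | y in [set y | eucl_norm y <= 1]].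

Let unit_image_has_sup M : has_sup (unit_image M).
Proof.
split; first by exists (eucl_norm (M *m 0)), 0; rewrite //= eucl_norm0 ler01.
exists (frobenius_norm M) => _ [y /= y1 <-].
rewrite (le_trans (eucl_norm_mul_frobenius M y))// ler_piMr//.
exact: sqrtr_ge0.
Qed.

Lemma op_norm_ge0 M : 0 <= op_norm M.
Proof.
apply: ub_le_sup; first by case: (unit_image_has_sup M).
by exists 0; rewrite /= ?mulmx0 eucl_norm0 ?ler01.
Qed.

Lemma eucl_norm_mul M y : eucl_norm (M *m y) <= op_norm M * eucl_norm y.
Proof.
have [y0|y0] := eqVneq (eucl_norm y) 0.
  by rewrite (le_trans (eucl_norm_mul_frobenius M y))// y0 !mulr0.
have ypos : 0 < eucl_norm y by rewrite lt_def y0 eucl_norm_ge0.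
rewrite -ler_pdivrMr// mulrC -[X in X * _]gtr0_norm ?invr_gt0//.
rewrite -eucl_normZ scalemxAr; apply: ub_le_sup.
  by case: (unit_image_has_sup M).
exists ((eucl_norm y)^-1 *: y) => //=.
by rewrite eucl_normZ gtr0_norm ?invr_gt0// mulVf.
Qed.

Lemma op_norm_le M c : 0 <= c ->
  (forall y, eucl_norm (M *m y) <= c * eucl_norm y) -> op_norm M <= c.
Proof.
move=> c0 Mc; apply: ge_sup; first by case: (unit_image_has_sup M).
move=> _ [y /= y1 <-]; rewrite (le_trans (Mc y))//.
by rewrite ler_piMr.
Qed.

Lemma op_norm_frobenius M : op_norm M <= frobenius_norm M.
Proof.
by apply: op_norm_le => [|y]; [exact: sqrtr_ge0|exact: eucl_norm_mul_frobenius].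
Qed.

Lemma op_norm_mulmx M N : op_norm (M *m N) <= op_norm M * op_norm N.
Proof.
apply: op_norm_le => [|y]; first by rewrite mulr_ge0 ?op_norm_ge0.
rewrite -mulmxA (le_trans (eucl_norm_mul _ _))// -mulrA.
by rewrite ler_wpM2l ?op_norm_ge0// eucl_norm_mul.
Qed.

Lemma op_normD M N : op_norm (M + N) <= op_norm M + op_norm N.
Proof.
apply: op_norm_le => [|y]; first by rewrite addr_ge0 ?op_norm_ge0.
by rewrite mulmxDl (le_trans (eucl_normD _ _))// mulrDl lerD ?eucl_norm_mul.
Qed.

Lemma op_norm_dist M N : `|op_norm M - op_norm N| <= frobenius_norm (M - N).
Proof.
have half M' N' : op_norm M' - op_norm N' <= frobenius_norm (M' - N').
  rewrite lerBlDr -{1}(subrK N' M') (le_trans (op_normD _ _))// lerD2r.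
  exact: op_norm_frobenius.
rewrite ler_norml half andbT lerNl opprB (le_trans (half _ _))//.
rewrite /frobenius_norm ler_wsqrtr//; apply: ler_sum => i _; apply: ler_sum => j _.
by rewrite !mxE -sqrrN opprB.
Qed.

End EuclideanNorm.

Lemma continuous_sum (R : realType) (T : topologicalType) (I : Type) (r : seq I)
    (u : I -> T -> R) : (forall i, continuous (u i)) ->
  continuous (fun x => \sum_(i <- r) u i x).
Proof.
move=> cu x; apply: (cvg_big add_continuous) => i _; exact: cu.
Qed.

Lemma continuous_op_norm (R : realType) (T : topologicalType) (d : nat)
    (M : T -> 'M[R]_d) : (forall i j, continuous (fun x => M x i j)) ->
  continuous (fun x => op_norm (M x)).
Proof.
move=> cM x; apply/cvgrPdist_le => e e0.
have : continuous (fun y => frobenius_norm (M x - M y)).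
  move=> y; apply: (continuous_comp _ (@sqrt_continuous R _)).
  apply: continuous_sum => i; apply: continuous_sum => j z.
  under eq_fun do rewrite !mxE expr2.
  apply: cvgM; apply: cvgB; try exact: cvg_cst; exact: cM.
move=> /(_ x) /cvgr_le /(_ e); rewrite subrr.
have -> : frobenius_norm (0 : 'M[R]_d) = 0.
  rewrite /frobenius_norm big1 ?sqrtr0// => i _.
  by rewrite big1// => j _; rewrite mxE expr0n.
move=> /(_ e0); apply: filterS => y; apply: le_trans.
exact: op_norm_dist.
Qed.

(** The columns of [M] have norm at most [op_norm M], and the determinant of [M],
    which is 1, is at most the product of these two norms. *)
Lemma op_norm_ge1_det1 (R : realType) (M : 'M[R]_2) : \det M = 1 -> 1 <= op_norm M.
Proof.
move=> detM; have opM := op_norm_ge0 M.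
have col (j : 'I_2) : M 0 j ^+ 2 + M 1 j ^+ 2 <= op_norm M ^+ 2.
  have := eucl_norm_mul M (delta_mx j 0).
  have -> : eucl_norm (delta_mx j 0 : 'cV[R]_2) = 1.
    rewrite /eucl_norm (bigD1 j)//= big1 ?mxE ?eqxx ?expr1n ?addr0 ?sqrtr1//.
    by move=> i ij; rewrite mxE (negbTE ij) expr0n.
  rewrite mulr1 -(@ler_pXn2r _ 2)// ?nnegrE ?eucl_norm_ge0//.
  rewrite eucl_norm_sqr -colE big_ord_recl big_ord1 !mxE.
  by rewrite (_ : lift ord0 ord0 = 1)//; exact: val_inj.
have := col 0; have := col 1; move: detM.
rewrite (expand_det_row _ 0) big_ord_recl big_ord1 /cofactor !det_mx11 !mxE/=.
rewrite (_ : lift 0 0 = 1 :> 'I_2); last exact: val_inj.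
rewrite (_ : lift 1 0 = 0 :> 'I_2); last exact: val_inj.
rewrite expr0 expr1.
move: (M 0 0) (M 0 1) (M 1 0) (M 1 1) => a b c e detM h1 h0.
rewrite leNgt; apply/negP => op1.
have op2 : op_norm M ^+ 2 < 1 by rewrite exprn_ilt1.
have ae_bc : a * e - b * c = 1 by rewrite -detM; ring.
have lagrange : (a ^+ 2 + c ^+ 2) * (b ^+ 2 + e ^+ 2) = 1 + (a * b + c * e) ^+ 2.
  by rewrite -(expr1n R 2) -ae_bc; ring.
have : 1 <= (a ^+ 2 + c ^+ 2) * (b ^+ 2 + e ^+ 2).
  by rewrite lagrange lerDl sqr_ge0.
apply/negP; rewrite -ltNge.
apply: (@le_lt_trans _ _ (op_norm M ^+ 2 * op_norm M ^+ 2)).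
  by apply: ler_pM => //; rewrite addr_ge0 ?sqr_ge0.
by rewrite mulr_ilt1 ?sqr_ge0.
Qed.

(** * Linear cocycles and their logarithmic norms *)

Section Cocycle.
Context (R : realType).

Lemma cocycleD (K : Type) (f : K -> K) (A : K -> 'M[R]_2) m n x :
  cocycle f A (m + n) x = cocycle f A m (iter n f x) *m cocycle f A n x.
Proof.
elim: m => [|m IHm]; first by rewrite mul1mx.
by rewrite addSn /= IHm mulmxA iterD.
Qed.

Lemma det_cocycle (K : Type) (f : K -> K) (A : K -> 'M[R]_2) n x :
  (forall x, \det (A x) = 1) -> \det (cocycle f A n x) = 1.
Proof.
by move=> detA; elim: n => [|n IHn] /=; rewrite ?det1// det_mulmx detA IHn mulr1.
Qed.

Lemma continuous_iter (K : topologicalType) (f : K -> K) n :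
  continuous f -> continuous (iter n f).
Proof.
move=> cf; elim: n => [|n IHn] x; first exact: cvg_id.
by apply: continuous_comp; [exact: IHn|exact: cf].
Qed.

Lemma continuous_cocycle (K : topologicalType) (f : K -> K) (A : K -> 'M[R]_2) n i j :
  continuous f -> continuous A -> continuous (fun x => cocycle f A n x i j).
Proof.
move=> cf cA; elim: n i j => [|n IHn] i j; first by move=> x; exact: cvg_cst.
move=> x /=; under eq_fun do rewrite mxE.
apply: continuous_sum => k y; apply: cvgM; last exact: IHn.
apply: (@continuous_comp _ _ _ (fun z => A (iter n f z)) (fun M => M i k)).
  by apply: continuous_comp; [exact: continuous_iter|exact: cA].
exact: coord_continuous.
Qed.

End Cocycle.

Section LogNorm.
Context (R : realType) (K : topologicalType) (f : K -> K) (A : K -> 'M[R]_2).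
Hypotheses (cf : continuous f) (cA : continuous A).
Hypothesis detA : forall x, \det (A x) = 1.

Definition log_norm (n : nat) (x : K) : R := ln (op_norm (cocycle f A n x)).

Let op_ge1 n x : 1 <= op_norm (cocycle f A n x).
Proof. by apply: op_norm_ge1_det1; exact: det_cocycle. Qed.

Let op_gt0 n x : 0 < op_norm (cocycle f A n x).
Proof. exact: lt_le_trans ltr01 (op_ge1 n x). Qed.

Lemma log_norm_ge0 n x : 0 <= log_norm n x.
Proof. exact: ln_ge0. Qed.

Lemma log_norm_le n x c : (op_norm (cocycle f A n x) <= expR c) = (log_norm n x <= c).
Proof. by rewrite -[in RHS](expRK c) ler_ln ?posrE ?expR_gt0. Qed.

Lemma log_normD m n x : log_norm (m + n) x <= log_norm m (iter n f x) + log_norm n x.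
Proof.
rewrite /log_norm -lnM ?posrE ?op_gt0// ler_ln ?posrE ?mulr_gt0 ?op_gt0//.
by rewrite cocycleD op_norm_mulmx.
Qed.

Lemma continuous_log_norm n : continuous (log_norm n).
Proof.
move=> x; apply: (@continuous_comp _ _ _ (fun y => op_norm (cocycle f A n y))).
  by apply: continuous_op_norm => i j; exact: continuous_cocycle.
exact: continuous_ln.
Qed.

End LogNorm.

(** * Subadditive sequences *)

Section Fekete.
Context (R : realType) (u : nat -> R).
Hypothesis uD : forall m n, u (m + n)%N <= u m + u n.

Lemma subadditive_mul_add n q r : u (q * n + r)%N <= q%:R * u n + u r.
Proof.
elim: q => [|q IHq]; first by rewrite mul0n add0n mul0r add0r.
rewrite mulSn -addnA (le_trans (uD _ _))// -natr1 mulrDl mul1r.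
by rewrite [X in _ <= X + _]addrC -addrA lerD2l.
Qed.

(** Divide [k] by [n]: the quotient contributes at most [c] per unit of time, and
    the remainder contributes a bounded amount, absorbed by [e * k] for [k] large. *)
Lemma subadditive_eventually_le n (c e : R) : (0 < n)%N -> u n <= c * n%:R ->
  0 < e -> exists N, (0 < N)%N /\ forall k, (N <= k)%N -> u k <= (c + e) * k%:R.
Proof.
move=> n0 unc e0.
(* Each summand bounds the excess of one remainder; their sum bounds them all. *)
pose B : R := \sum_(r < n) (`|u r| + `|c| * n%:R).
have uB r : (r < n)%N -> u r - c * r%:R <= B.
  move=> rn; rewrite /B (bigD1 (Ordinal rn))//= -[leLHS]addr0 lerD//; last first.
    by apply: sumr_ge0 => i _; rewrite addr_ge0 ?mulr_ge0.
  rewrite lerD ?ler_norm// (le_trans (ler_norm _))// normrN normrM normr_nat.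
  by rewrite ler_wpM2l// ler_nat ltnW.
exists (Num.truncn (B / e)).+1; split => // k Nk.
rewrite (divn_eq k n) (le_trans (subadditive_mul_add _ _ _))//.
set q := (k %/ n)%N; set r := (k %% n)%N.
have Bk : B <= e * k%:R.
  rewrite mulrC -ler_pdivrMr// ltW// (lt_le_trans (truncnS_gt _))// ler_nat//.
have qn : q%:R * u n <= q%:R * (c * n%:R) by rewrite ler_wpM2l.
have kE : k%:R = q%:R * n%:R + r%:R :> R by rewrite {1}(divn_eq k n) natrD natrM.
rewrite natrD natrM -kE mulrDl.
have := uB _ (ltn_pmod k n0); rewrite -/r => ur.
have -> : c * k%:R = q%:R * (c * n%:R) + c * r%:R by rewrite kE; ring.
by lra.
Qed.

(** The limit is the infimum of [u n / n] over [n > 0]: a time at which the quotient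
    is close to the infimum bounds all late quotients from above, up to [e]. *)
Lemma fekete : (forall n, 0 <= u n) -> cvg ((fun n => n%:R^-1 * u n) @ \oo).
Proof.
move=> u0; pose S := [set n%:R^-1 * u n | n in [set n | (0 < n)%N]].
have S0 : has_inf S.
  split; first by exists (1^-1 * u 1%N), 1%N.
  by exists 0 => _ [n _ <-]; rewrite mulr_ge0 ?invr_ge0.
apply/cvg_ex; exists (inf S); apply/cvgrPdist_le => e e0.
have e20 : 0 < e / 2 by rewrite divr_gt0.
have [_ [n /= n0 <-] un] := inf_adherent e20 S0.
have [|N [_ NP]] := @subadditive_eventually_le n (inf S + e / 2) (e / 2) n0 _ e20.
  by rewrite -ler_pdivrMr ?ltr0n// mulrC ltW.
near=> k.
have k0 : (0 < k)%N by near: k; exact: nbhs_infty_gt.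
have kinf : inf S <= k%:R^-1 * u k by apply: ge_inf; [case: S0|exists k].
rewrite distrC ger0_norm ?subr_ge0// lerBlDl mulrC ler_pdivrMr ?ltr0n//.
rewrite (splitr e) addrA; apply: NP; near: k; exact: nbhs_infty_ge.
Unshelve. all: by end_near. Qed.

End Fekete.

(** * Subadditive families of functions over a dynamical system *)

Section SubadditiveCocycle.
Context (R : realType) (K : ptopologicalType) (compK : compact [set: K]).
Context (f : K -> K) (cf : continuous f) (phi : nat -> K -> R).
Hypotheses (cphi : forall n, continuous (phi n)) (phi0 : forall n x, 0 <= phi n x).
Hypothesis phiD : forall m n x, phi (m + n) x <= phi m (iter n f x) + phi n x.

Definition time_sup n : R := sup (range (phi n)).

Lemma le_time_sup n x : phi n x <= time_sup n.
Proof.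
apply: ub_le_sup; last by exists x.
have [b bP] := compact_continuous_ub compK (@cphi n).
by exists b => _ [y _ <-]; rewrite (le_trans (ler_norm _))// ltW.
Qed.

Lemma time_sup_le n c : (forall x, phi n x <= c) -> time_sup n <= c.
Proof.
by move=> phic; apply: ge_sup => [|_ [y _ <-]//]; exists (phi n point), point.
Qed.

Lemma time_supD m n : time_sup (m + n) <= time_sup m + time_sup n.
Proof.
by apply: time_sup_le => x; rewrite (le_trans (phiD _ _ _))// lerD ?le_time_sup.
Qed.

Lemma uniform_subexponential_iff :
  (forall e : R, 0 < e -> exists N, (0 < N)%N /\
     forall x n, (N <= n)%N -> phi n x <= e * n%:R) <->
  (forall e : R, 0 < e -> exists n, (0 < n)%N /\ forall x, phi n x <= e * n%:R).
Proof.
split=> H e e0; first by have [N [N0 NP]] := H e e0; exists N; split=> // x; exact: NP.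
have e20 : 0 < e / 2 by rewrite divr_gt0.
have [n [n0 /time_sup_le nP]] := H _ e20.
have [N [N0 NP]] := subadditive_eventually_le time_supD n0 nP e20.
exists N; split=> // x k /NP; rewrite -splitr; apply: le_trans.
exact: le_time_sup.
Qed.

(** Moving the window [n, n + m) one step forward replaces [phi n] by
    [phi (n + m)], which exceeds it by at most [phi m] at the [n]-th iterate. *)
Lemma window_sum_le m n x :
  \sum_(i < m) phi (n + i) x <=
  \sum_(i < m) phi i x + \sum_(j < n) phi m (iter j f x).
Proof.
elim: n => [|n IHn]; first by rewrite big_ord0 addr0.
rewrite big_ord_recr/= addrA.
apply: (@le_trans _ _ (\sum_(i < m) phi (n + i) x + phi m (iter n f x))); last first.
  by rewrite lerD2r.
have : \sum_(i < m) phi (n.+1 + i) x + phi n x =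
    \sum_(i < m) phi (n + i) x + phi (m + n) x.
  under eq_bigr do rewrite addSnnS.
  rewrite -[X in phi X x](addn0 n) addrC.
  rewrite -(big_ord_recl m (fun i => phi (n + i) x))/= .
  by rewrite big_ord_recr/= [(n + m)%N]addnC.
have := phiD m n x; lra.
Qed.

(** Each of the [m] ways to reach time [n] through a time in the window
    [n - m, n) bounds [phi n x], up to a constant, by the value of [phi] at that
    intermediate time. Adding them bounds [m * phi n x] by a window sum, which
    [window_sum_le] compares with the Birkhoff sum of [phi m]. This avoids
    splitting the segment into blocks of length [m] for every residue. *)
Lemma birkhoff_sum_ge m : exists B : R, forall n x, (m <= n)%N ->
  m%:R * phi n x <= \sum_(j < n) phi m (iter j f x) + B.
Proof.
pose B : R := \sum_(i < m.+1) time_sup i.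
have s0 i : 0 <= time_sup i := le_trans (phi0 i point) (le_time_sup i point).
have phiB i x : (i <= m)%N -> phi i x <= B.
  move=> im; rewrite (le_trans (le_time_sup i x))// /B.
  rewrite (bigD1 (Ordinal (im : (i < m.+1)%N)))//= lerDl.
  by apply: sumr_ge0.
(* One share pays for the steps from the window to time n, the other for the
   initial window. *)
exists (m%:R * B + m%:R * B) => n x /subnK <-; set k := (n - m)%N.
apply: (@le_trans _ _ (\sum_(i < m) (phi (k + i) x + B))).
  rewrite mulr_natl -[X in _ *+ X]card_ord -sumr_const; apply: ler_sum => i _.
  have -> : (k + m = (m - i) + (k + i))%N by rewrite addnCA subnK// ltnW.
  rewrite (le_trans (phiD _ _ _))// addrC lerD2l.
  by apply: phiB; exact: leq_subr.
rewrite big_split/= sumr_const card_ord -[B *+ m]mulr_natl addrA lerD2r.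
rewrite (le_trans (window_sum_le _ _ _))// addrC lerD//.
  rewrite mulr_natl -[X in _ *+ X]card_ord -sumr_const; apply: ler_sum => i _.
  by apply: phiB; exact: ltnW.
by rewrite big_split_ord/= lerDl sumr_ge0.
Qed.

Variable mu : probability (borelType K) R.

Let mean n : R := \int[mu]_x phi n x.

Let iphi n : mu.-integrable setT (EFin \o phi n).
Proof. exact: continuous_integrable_borel. Qed.

Lemma invariant_Rintegral_iter (psi : K -> R) n : invariant_measure f mu ->
  continuous psi -> (forall x, 0 <= psi x) ->
  \int[mu]_x psi (iter n f x) = \int[mu]_x psi x.
Proof.
move=> muf cpsi psi0; elim: n => // n <-.
pose h x := psi (iter n f x).
have ch : continuous h.
  by move=> x; apply: continuous_comp; [exact: continuous_iter|exact: cpsi].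
transitivity (\int[mu]_x (h \o f) x).
  by apply: eq_Rintegral => x _; rewrite -[RHS]/(psi (iter n f (f x))) -iterSr.
rewrite /Rintegral; congr fine.
have mf := continuous_measurable_borel_self cf.
transitivity (\int[pushforward mu (f : borelType K -> borelType K)]_x (h x)%:E)%E.
  rewrite ge0_integral_pushforward//; last by move=> x _; rewrite lee_fin psi0.
  by apply/measurable_EFinP; exact: continuous_measurable_borel.
by apply: eq_measure_integral => B mB _; exact: muf.
Qed.

Lemma mean_subadditive : invariant_measure f mu ->
  forall m n, mean (m + n) <= mean m + mean n.
Proof.
move=> muf m n; rewrite /mean.
have cfn : continuous (fun x => phi m (iter n f x)).
  by move=> x; apply: continuous_comp; [exact: continuous_iter|exact: cphi].
have ifn : mu.-integrable setT (EFin \o (fun x => phi m (iter n f x))).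
  exact: continuous_integrable_borel.
rewrite -(invariant_Rintegral_iter n muf (@cphi m) (phi0 m)) -RintegralD//.
apply: le_Rintegral => //.
apply: continuous_integrable_borel => // x; apply: cvgD; [exact: cfn|exact: cphi].
Qed.

Lemma mean_growth_cvg0 :
  (forall e : R, 0 < e -> exists N, (0 < N)%N /\
     forall x n, (N <= n)%N -> phi n x <= e * n%:R) ->
  (fun n => n%:R^-1 * mean n) @ \oo --> (0 : R).
Proof.
move=> H; apply/cvgrPdist_le => e e0; have [N [N0 NP]] := H e e0.
near=> n; have n0 : (0 < n)%N by near: n; exact: nbhs_infty_gt.
have mean0 : 0 <= mean n by apply: Rintegral_ge0 => x _; exact: phi0.
rewrite sub0r normrN ger0_norm ?mulr_ge0 ?invr_ge0//.
rewrite mulrC ler_pdivrMr ?ltr0n//.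
have <- : \int[mu]_x (e * n%:R) = e * n%:R.
  rewrite Rintegral_cst// [X in fine X](_ : _ = 1%E) ?mulr1//.
  exact: probability_setT.
apply: le_Rintegral => //.
  by apply: continuous_integrable_borel => // x; exact: cvg_cst.
by move=> x _; apply: NP; near: n; exact: nbhs_infty_ge.
Unshelve. all: by end_near. Qed.

End SubadditiveCocycle.

(** If the conclusion fails, the orbit segments of fast growth yield an invariant
    measure whose means [\int phi m] grow at least like [e * m]. The growth rate of
    these means converges by [fekete], so its limit is at least [e]. *)
Lemma uniform_growth_of_invariant_means (R : realType) (K : ptopologicalType)
    (hausK : hausdorff_space K) (compK : compact [set: K])
    (f : K -> K) (homeof : homeomorphism f) (phi : nat -> K -> R) :
  (forall n, continuous (phi n)) -> (forall n x, 0 <= phi n x) ->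
  (forall m n x, phi (m + n) x <= phi m (iter n f x) + phi n x) ->
  (forall mu : probability (borelType K) R, invariant_measure f mu ->
     lim ((fun n => n%:R^-1 * \int[mu]_x phi n x) @ \oo) = 0) ->
  forall e : R, 0 < e -> exists n, (0 < n)%N /\ forall x, phi n x <= e * n%:R.
Proof.
move=> cphi phi0 phiD lim0 e e0; apply: contrapT => nH.
have xP n : exists x, (0 < n)%N -> e * n%:R < phi n x.
  apply: contrapT => nx; apply: nH; exists n; split; first last.
    by move=> x; rewrite leNgt; apply/negP => xn; apply: nx; exists x.
  by rewrite lt0n; apply/negP => n0; apply: nx; exists point; rewrite lt0n n0.
have [x {}xP] := choice xP.
have cf : continuous f by case: homeof => g [].
have [mu [muf mu_ge]] := invariant_measure_of_orbit_segments R hausK compK homeof x.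
have mean_ge m : e * m%:R <= \int[mu]_y phi m y.
  have [B BP] := birkhoff_sum_ge compK cphi phi0 phiD m.
  apply/ler_addgt0Pr => d d0; rewrite -lerBlDr; apply: mu_ge => //.
  near=> n.
  have n0 : (0 < n)%N by near: n; exact: nbhs_infty_gt.
  have mn : (m <= n)%N by near: n; exact: nbhs_infty_ge.
  rewrite /segment_average [leRHS]mulrC ler_pdivlMr ?ltr0n//.
  have dB : B <= d * n%:R.
    rewrite mulrC -ler_pdivrMr// ltW// (lt_le_trans (truncnS_gt _))// ler_nat.
    by near: n; exact: nbhs_infty_ge.
  have := BP n (x n) mn.
  have : m%:R * (e * n%:R) <= m%:R * phi n (x n) by rewrite ler_wpM2l// ltW// xP.
  rewrite mulrBl; have -> : e * m%:R * n%:R = m%:R * (e * n%:R) by ring.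
  lra.
have : e <= lim ((fun n => n%:R^-1 * \int[mu]_y phi n y) @ \oo).
  apply: limr_ge.
    apply: fekete => [m n|n]; first exact: mean_subadditive.
    by apply: Rintegral_ge0 => y _; exact: phi0.
  near=> n; have n0 : (0 < n)%N by near: n; exact: nbhs_infty_gt.
  by rewrite mulrC ler_pdivlMr ?ltr0n.
by rewrite lim0// leNgt e0.
Unshelve. all: by end_near. Qed.

Theorem proposition1 (R : realType) (K : ptopologicalType)
    (hausK : hausdorff_space K) (compK : compact [set: K])
    (f : K -> K) (homeof : homeomorphism f)
    (A : K -> 'M[R]_2) (contA : continuous A)
    (SLA : forall x : K, \det (A x) = 1) :
  ((forall eps : R, 0 < eps -> exists N : nat, (0 < N)%N /\
      forall (x : K) (n : nat), (N <= n)%N ->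
        op_norm (cocycle f A n x) <= expR (eps * n%:R))
   <->
   (forall eps : R, 0 < eps -> exists n : nat, (0 < n)%N /\
      forall x : K, op_norm (cocycle f A n x) <= expR (eps * n%:R)))
  /\
  ((forall eps : R, 0 < eps -> exists n : nat, (0 < n)%N /\
      forall x : K, op_norm (cocycle f A n x) <= expR (eps * n%:R))
   <->
   (forall mu : probability (borelType K) R,
      invariant_measure f mu -> lyapunov_exponent f A mu = 0)).
Proof.
have cf : continuous f by case: homeof => g [].
pose phi := log_norm f A.
have cphi n : continuous (phi n) by exact: continuous_log_norm.
have phi0 n x : 0 <= phi n x by exact: log_norm_ge0.
have phiD m n x : phi (m + n)%N x <= phi m (iter n f x) + phi n x.
  exact: log_normD.
have ab := uniform_subexponential_iff compK cphi phiD.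
have expE n x (c : R) : (op_norm (cocycle f A n x) <= expR c) = (phi n x <= c).
  exact: log_norm_le.
have -> : (forall eps : R, 0 < eps -> exists n : nat, (0 < n)%N /\
      forall x : K, op_norm (cocycle f A n x) <= expR (eps * n%:R)) =
    (forall eps : R, 0 < eps -> exists n : nat, (0 < n)%N /\
      forall x : K, phi n x <= eps * n%:R).
  by under eq_forall do under eq_forall do under eq_exists do
    under eq_forall do rewrite expE.
split.
  rewrite -ab; split=> H e e0; have [N [N0 NP]] := H e e0; exists N; split=> //;
    by move=> x n Nn; have := NP x n Nn; rewrite expE.
split=> [/ab H mu muf|]; last exact: uniform_growth_of_invariant_means.
by apply: cvg_lim => //; exact: mean_growth_cvg0.
Qed.
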